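(* Let $G$ be a finite group and regard $Mod_{\mathbb{C}}(G)$ as a strict monoidal category. A family of $G$-morphisms $\hat q_{\alpha,\beta}^\gamma\in End(c_{\alpha\beta}^\gamma E_\gamma)$, $\alpha,\beta,\gamma\in\hat G$, defines a quantizer $$q=\frac{1}{|G|^2}\sum_{g,h\in G}\ \sum_{\alpha,\beta\in\hat G}d_{\alpha,\beta}\sum_{\gamma\in\hat G}Tr\big(D^{\alpha,\beta}_{\gamma}(g,h)^*\,\hat q_{\alpha,\beta}^\gamma\big)\cdot(g,h)\in\mathbb{C}[G\times G]$$ if and only if these operators are solutions of the following system of quadratic equations: for all $\alpha,\beta,\gamma\in\hat G$, $$\sum_{\eta,\zeta\in\hat G}\hat q^\zeta_{\alpha,\eta}\,\hat q^\eta_{\beta,\gamma}=\sum_{\zeta,\xi\in\hat G}\hat q^\zeta_{\xi,\gamma}\,\hat q^\xi_{\alpha,\beta},$$ $$\hat q_{\alpha,0}^\alpha=\hat q_{0,\alpha}^\alpha=1,$$ where the two sides of the first equation are operators on $E_\alpha\otimes E_\beta\otimes E_\gamma$.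
   Context: $Mod_{\mathbb{C}}(G)$ is the monoidal category of finitely generated $\mathbb{C}[G]$-modules with tensor product over $\mathbb{C}$ and diagonal action. A quantizer is an element $q=\sum q_{g,h}(g,h)\in\mathbb{C}[G\times G]$ such that $Q_{X,Y}(x\otimes y)=\sum q_{g,h}\,gx\otimes hy$ is a quantization: a natural family of $G$-morphisms $Q_{X,Y}:X\otimes Y\to X\otimes Y$ with $Q_{X,Y\otimes Z}\circ(1\otimes Q_{Y,Z})=Q_{X\otimes Y,Z}\circ(Q_{X,Y}\otimes1)$ and with $Q_{X,\mathbb{C}}=\mathrm{id}$, $Q_{\mathbb{C},X}=\mathrm{id}$. $\hat G$ is the set of equivalence classes of irreducible complex representations of $G$, and $0\in\hat G$ is the trivial one. For $\alpha\in\hat G$, $E_\alpha$ is the corresponding irreducible module, $d_\alpha=\dim E_\alpha$, realized by unitary matrices $D^\alpha(g)$; $D^{\alpha,\beta}(g,h)=D^\alpha(g)\otimes D^\beta(h)$, $d_{\alpha,\beta}=d_\alpha d_\beta$, and ${}^*$ is the conjugate transpose. The Clebsch–Gordan integers $c_{\alpha\beta}^\gamma$ are the multiplicities in fixed (unitary) $G$-isomorphisms $\nu_{\alpha,\beta}:E_\alpha\otimes E_\beta\to\bigoplus_\gamma c_{\alpha\beta}^\gamma E_\gamma$, where $cE=\mathbb{C}^c\otimes E$. $D^{\alpha,\beta}_\gamma(g,h)$ is the component (diagonal block) $c_{\alpha\beta}^\gamma E_\gamma\to c_{\alpha\beta}^\gamma E_\gamma$ of $D^{\alpha,\beta}(g,h)$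 with respect to this decomposition. A $G$-morphism $\hat q_{\alpha,\beta}^\gamma$ of $c_{\alpha\beta}^\gamma E_\gamma$ is given by a $c_{\alpha\beta}^\gamma\times c_{\alpha\beta}^\gamma$ matrix. Put $\hat q_{\alpha,\beta}=\bigoplus_\gamma\hat q_{\alpha,\beta}^\gamma\in End(E_\alpha\otimes E_\beta)$ (via $\nu_{\alpha,\beta}$). The left side of the quadratic equation means the composition of $1\otimes\hat q_{\beta,\gamma}=1\otimes\bigoplus_\eta\hat q_{\beta,\gamma}^\eta$ on $E_\alpha\otimes\bigoplus_\eta c_{\beta\gamma}^\eta E_\eta$ followed by $\bigoplus_\eta\hat q_{\alpha,\eta}=\bigoplus_{\eta,\zeta}\hat q_{\alpha,\eta}^\zeta$ (extended by the identity on the multiplicity spaces $\mathbb{C}^{c_{\beta\gamma}^\eta}$), transported to $E_\alpha\otimes E_\beta\otimes E_\gamma$ via $\nu_{\beta,\gamma}$ and $\nu_{\alpha,\eta}$. The right side means the composition of $\hat q_{\alpha,\beta}\otimes1=\bigoplus_\xi\hat q_{\alpha,\beta}^\xi\otimes1$ on $\big(\bigoplus_\xi c_{\alpha\beta}^\xi E_\xi\big)\otimes E_\gamma$ followed by $\bigoplus_{\xi}\hat q_{\xi,\gamma}=\bigoplus_{\xi,\zeta}\hat q_{\xi,\gamma}^\zeta$ (extended by the identity on $\mathbb{C}^{c_{\alpha\beta}^\xi}$), transported via $\nu_{\alpha,\beta}$ and $\nu_{\xi,\gamma}$. *)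

(* Defs.v *)
From HB Require Import structures.
From mathcomp Require Import all_boot all_order all_algebra all_fingroup.
From mathcomp Require Import mxrepresentation.
From mathcomp Require Import mxtens.
Set Implicit Arguments.
Unset Strict Implicit.
Unset Printing Implicit Defensive.
Import GRing.Theory.
Local Open Scope ring_scope.
Local Open Scope sesquilinear_scope.

(* Conventions.  A finitely generated C[G]-module is given in coordinates by a
   matrix representation r : mx_representation C [set: gT] n, with g acting on
   the column vectors 'cV_n by v |-> r g *m v; this is a left module since
   r (g * h) = r g *m r h.  A linear map from a module of dimension n to one of
   dimension m is an 'M_(m, n), and composition is *m.  The tensor product is
   the Kronecker product *t; the basis vector e_i (x) e_j has index
   mxtens_index (i, j), of value i * m + j, so that the two bracketings of a
   triple product have the same ordered basis and casting along mulnA is the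
   strict associativity of the tensor product. *)

Section Modules.

Variables (C : numClosedFieldType) (gT : finGroupType).

Local Notation gmod := (mx_representation C [set: gT]).

Definition intertwines n m (r : gT -> 'M[C]_n) (s : gT -> 'M[C]_m)
  (f : 'M[C]_(m, n)) : Prop := forall g : gT, f *m r g = s g *m f.

Lemma tens_mx_repr n m (r : gmod n) (s : gmod m) :
  mx_repr [set: gT] (fun g => r g *t s g).
Proof.
split=> [|g h Gg Gh].
  rewrite !repr_mx1; apply/matrixP => i j.
  case: (mxtens_indexP i) => i1 i2; case: (mxtens_indexP j) => j1 j2.
  rewrite tensmxE !mxE -natrM mulnb; congr (_%:R); congr nat_of_bool.
  by rewrite (can_eq (@mxtens_indexK n m)) xpair_eqE.
by rewrite !repr_mxM // tensmx_mul.
Qed.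

Definition tens_repr n m (r : gmod n) (s : gmod m) : gmod (n * m) :=
  MxRepresentation (tens_mx_repr r s).

Lemma triv_mx_repr : mx_repr [set: gT] (fun _ => 1%:M : 'M[C]_1).
Proof. by split=> // g h _ _; rewrite mulmx1. Qed.

Definition triv_repr : gmod 1 := MxRepresentation triv_mx_repr.

Record is_quantization
    (Q : forall n m, gmod n -> gmod m -> 'M[C]_(n * m)) : Prop := {
  quant_morph : forall n m (X : gmod n) (Y : gmod m),
    intertwines (tens_repr X Y) (tens_repr X Y) (Q n m X Y);
  quant_natural : forall n n' m m' (X : gmod n) (X' : gmod n')
      (Y : gmod m) (Y' : gmod m') (f : 'M[C]_(n', n)) (h : 'M[C]_(m', m)),
    intertwines X X' f -> intertwines Y Y' h ->
    (f *t h) *m Q n m X Y = Q n' m' X' Y' *m (f *t h);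
  quant_coherent : forall n m p (X : gmod n) (Y : gmod m) (Z : gmod p),
    castmx (mulnA n m p, mulnA n m p)
      (Q n (m * p)%N X (tens_repr Y Z) *m (1%:M *t Q m p Y Z))
    = Q (n * m)%N p (tens_repr X Y) Z *m (Q n m X Y *t 1%:M);
  quant_unitr : forall n (X : gmod n), Q n 1%N X triv_repr = 1%:M;
  quant_unitl : forall n (X : gmod n), Q 1%N n triv_repr X = 1%:M }.

(* An element of C[G x G] is the function of its coefficients. *)
Definition quantizer_action (q : {ffun gT * gT -> C})
    n m (X : gmod n) (Y : gmod m) : 'M[C]_(n * m) :=
  \sum_(g : gT) \sum_(h : gT) q (g, h) *: (X g *t Y h).

Definition is_quantizer (q : {ffun gT * gT -> C}) : Prop :=
  is_quantization (quantizer_action q).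

(* A numbering of the isomorphism classes of irreducible representations, with
   a unitary realization of each of them.  mx_irreducible speaks of invariant
   row spaces rather than column spaces; since orthogonal complements exchange
   the two, it is irreducibility in the usual sense. *)
Record irr_reps := IrrReps {
  nirr : nat;
  irr_dim : 'I_nirr -> nat;
  irr_mx : forall a, gmod (irr_dim a);
  irr_mx_irr : forall a, mx_irreducible (irr_mx a);
  irr_mx_inj : forall a b, mx_rsim (irr_mx a) (irr_mx b) -> a = b;
  irr_mx_complete : forall n (X : gmod n),
    mx_irreducible X -> exists a, mx_rsim X (irr_mx a);
  irr_mx_unitary : forall a g, irr_mx a g \is unitarymx;
  irr0 : 'I_nirr;
  irr0_triv : mx_rsim (irr_mx irr0) triv_repr }.

Section ClebschGordan.

Variable D : irr_reps.

(* C^c (x) E_k *)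
Definition mult_repr (c : nat) (k : 'I_(nirr D)) (g : gT) :
  'M[C]_(c * irr_dim k) := (1%:M : 'M_c) *t irr_mx k g.

Record clebsch_gordan := ClebschGordan {
  cg_mult : 'I_(nirr D) -> 'I_(nirr D) -> 'I_(nirr D) -> nat;
  cg_iso : forall a b,
    'M[C]_(\sum_k cg_mult a b k * irr_dim k, irr_dim a * irr_dim b);
  cg_iso_unitary : forall a b,
    cg_iso a b *m (cg_iso a b) ^t* = 1%:M /\
    (cg_iso a b) ^t* *m cg_iso a b = 1%:M;
  cg_iso_morph : forall a b,
    intertwines (tens_repr (irr_mx a) (irr_mx b))
      (fun g => \mxdiag_k mult_repr (cg_mult a b k) k g) (cg_iso a b) }.

Variable N : clebsch_gordan.

Definition cg_block a b k (g h : gT) : 'M[C]_(cg_mult N a b k * irr_dim k) :=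
  submxblock (cg_iso N a b *m (irr_mx a g *t irr_mx b h) *m (cg_iso N a b) ^t*)
    k k.

(* The map E_a (x) E_b -> E_k onto the i-th copy of E_k in
   C^c (x) E_k = E_k (+) ... (+) E_k; its adjoint is the inclusion. *)
Definition cg_proj a b k (i : 'I_(cg_mult N a b k)) :
  'M[C]_(irr_dim k, irr_dim a * irr_dim b) :=
  rowsub (fun s => mxtens_index (i, s)) (submxcol (cg_iso N a b) k).

Variable qh : forall a b k, 'M[C]_(cg_mult N a b k * irr_dim k).

Definition quantizer_of : {ffun gT * gT -> C} :=
  [ffun gh : gT * gT =>
    (#|[set: gT]|%:R ^+ 2)^-1 *
    \sum_a \sum_b (irr_dim a * irr_dim b)%:R *
      \sum_k \tr ((cg_block a b k gh.1 gh.2) ^t* *m qh a b k)].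

Definition qh_op a b : 'M[C]_(irr_dim a * irr_dim b) :=
  (cg_iso N a b) ^t* *m (\mxdiag_k qh a b k) *m cg_iso N a b.

(* The operator (+)_e qh_(a,e) on E_a (x) ((+)_e C^c (x) E_e), c = cg_mult b c e,
   which is the identity on C^c, transported to E_a (x) (E_b (x) E_c): it acts
   by qh_(a,e) on E_a (x) each copy of E_e. *)
Definition qh_op_tensr a b c :
  'M[C]_(irr_dim a * (irr_dim b * irr_dim c)) :=
  \sum_e \sum_(i < cg_mult N b c e)
    (1%:M *t cg_proj i) ^t* *m qh_op a e *m (1%:M *t cg_proj i).

Definition qh_op_tensl a b c :
  'M[C]_(irr_dim a * irr_dim b * irr_dim c) :=
  \sum_x \sum_(i < cg_mult N a b x)
    (cg_proj i *t 1%:M) ^t* *m qh_op x c *m (cg_proj i *t 1%:M).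

Definition quadratic_system : Prop :=
  (forall a b c,
     castmx (mulnA _ _ _, mulnA _ _ _)
       (qh_op_tensr a b c *m (1%:M *t qh_op b c))
     = qh_op_tensl a b c *m (qh_op a b *t 1%:M)) /\
  (forall a, qh a (irr0 D) a = 1%:M /\ qh (irr0 D) a a = 1%:M).

End ClebschGordan.

End Modules.

(* Main.v *)
Require Import Defs.
From HB Require Import structures.
From mathcomp Require Import all_boot all_order all_algebra all_fingroup.
From mathcomp Require Import mxrepresentation.
From mathcomp Require Import mxtens complex reals ring.
Set Implicit Arguments.
Unset Strict Implicit.
Unset Printing Implicit Defensive.
Import GRing.Theory.
Local Open Scope ring_scope.
Local Open Scope sesquilinear_scope.

(** An element q of C[G x G] acts on every X (x) Y by a combination of the maps
    X g (x) Y h, so its action commutes with f (x) h for all intertwiners f and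
    h (action_natural): naturality costs nothing.  Both sides of the coherence
    equation, of the unit equations and of the G-equivariance equation inherit
    this naturality.  By Maschke's theorem the identity of any module is a sum
    of composites through irreducible modules (irr_span), so a natural equation
    holds on all modules as soon as it holds on irreducible ones
    (coherent_ext, action_intertwines_ext, action_unitr_ext,
    action_unitl_ext).

    On irreducible modules the action of the element q attached to a family
    qh is computed by Fourier inversion.  Summing the traces over the diagonal
    blocks of the Clebsch-Gordan decomposition gives the trace against the
    whole operator qh_op a b (quantizer_ofE), so q is the inverse Fourier
    transform of the family qh_op on the group G x G, whose irreducible modules
    are the E_a (x) E_b.  The Schur orthogonality relations then show that q
    acts on E_a (x) E_b by qh_op a b (action_quantizer_of).

    It remains to read the equations on irreducible modules.  The operator of
    q on E_a (x) (E_b (x) E_c) involves a reducible second factor; since the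
    Clebsch-Gordan projections P_i : E_b (x) E_c -> E_e satisfy
    sum P_i^* P_i = 1, naturality expresses it as the sum of the
    (1 (x) P_i)^* qh_op a e (1 (x) P_i), which is the operator of the quadratic
    system (action_decompr, action_decompl).  So coherence on irreducible
    modules is the quadratic equation.  Equivariance holds because qh consists
    of G-morphisms.  For the unit equations, E_0 is isomorphic to the trivial
    module, and E_a (x) E_0 contains only E_a by Schur's lemma, so that
    qh_op a 0 = 1 says no more than that its block of index a is 1. *)

(** * Kronecker products and block diagonal matrices *)

Section TensorAlgebra.

Variable C : numClosedFieldType.

Lemma tensmxDl m n p q (A B : 'M[C]_(m, n)) (M : 'M[C]_(p, q)) :
  (A + B) *t M = A *t M + B *t M.
Proof. by apply/matrixP=> i j; rewrite !mxE mulrDl. Qed.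

Lemma tensmxDr m n p q (M : 'M[C]_(m, n)) (A B : 'M[C]_(p, q)) :
  M *t (A + B) = M *t A + M *t B.
Proof. by apply/matrixP=> i j; rewrite !mxE mulrDr. Qed.

Lemma tensmx_suml I r (P : pred I) m n p q (A : I -> 'M[C]_(m, n))
    (M : 'M[C]_(p, q)) :
  (\sum_(i <- r | P i) A i) *t M = \sum_(i <- r | P i) A i *t M.
Proof.
by elim/big_rec2: _ => [|i x y _ <-]; rewrite ?tens0mx ?tensmxDl.
Qed.

Lemma tensmx_sumr I r (P : pred I) m n p q (M : 'M[C]_(m, n))
    (A : I -> 'M[C]_(p, q)) :
  M *t (\sum_(i <- r | P i) A i) = \sum_(i <- r | P i) M *t A i.
Proof.
by elim/big_rec2: _ => [|i x y _ <-]; rewrite ?tensmx0 ?tensmxDr.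
Qed.

Lemma tensmx11 m n : (1%:M : 'M[C]_m) *t (1%:M : 'M[C]_n) = 1%:M.
Proof.
apply/matrixP => i j; case: (mxtens_indexP i) => i1 i2.
case: (mxtens_indexP j) => j1 j2.
rewrite tensmxE !mxE -natrM mulnb; congr (_%:R); congr nat_of_bool.
by rewrite (can_eq (@mxtens_indexK m n)) xpair_eqE.
Qed.

Lemma adj_mul m n p (A : 'M[C]_(m, n)) (B : 'M[C]_(n, p)) :
  (A *m B) ^t* = B ^t* *m A ^t*.
Proof. by rewrite trmx_mul map_mxM. Qed.

Lemma adj_tens m n p q (A : 'M[C]_(m, n)) (B : 'M[C]_(p, q)) :
  (A *t B) ^t* = A ^t* *t B ^t*.
Proof. by rewrite trmx_tens map_mxT. Qed.

Lemma adj1 n : (1%:M : 'M[C]_n) ^t* = 1%:M.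
Proof. by rewrite trmx1 map_mx1. Qed.

Lemma castmxM m m' n n' p p' (e : m = m') (f : n = n') (h : p = p')
    (A : 'M[C]_(m, n)) (B : 'M[C]_(n, p)) :
  castmx (e, h) (A *m B) = castmx (e, f) A *m castmx (f, h) B.
Proof. by case: m' / e; case: n' / f; case: p' / h. Qed.

(** The entry of index k of a triple product, for either bracketing, is located
    by the same three digits of k in the mixed radix (n, p). *)
Lemma tensmxA m n p m' n' p' (A : 'M[C]_(m, m')) (B : 'M[C]_(n, n'))
    (D : 'M[C]_(p, p')) :
  castmx (mulnA m n p, mulnA m' n' p') (A *t (B *t D)) = A *t B *t D.
Proof.
have arith k a b : ((k %/ (a * b) = k %/ b %/ a)%N
    * (k %% (a * b) %/ b = k %/ b %% a)%N * (k %% (a * b) %% b = k %% b)%N)%type.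
  by rewrite mulnC divnMA modn_divl mulnC modn_dvdm ?dvdn_mull.
apply/matrixP => i j; rewrite castmxE !mxE mulrA.
by congr (A _ _ * B _ _ * D _ _); apply: val_inj; rewrite /= arith.
Qed.

Lemma sum_mxtens (V : nmodType) m n (F : 'I_(m * n) -> V) :
  \sum_k F k = \sum_i \sum_j F (mxtens_index (i, j)).
Proof.
rewrite pair_big (reindex (@mxtens_index m n)) /=.
  by apply: eq_bigr => -[].
by exists (@mxtens_unindex m n) => k _; rewrite ?mxtens_indexK ?mxtens_unindexK.
Qed.

Lemma mul_mxdiag p (p_ : 'I_p -> nat) (A B : forall i, 'M[C]_(p_ i)) :
  (\mxdiag_i A i) *m (\mxdiag_i B i) = \mxdiag_i (A i *m B i).
Proof.
rewrite {2}/mxdiag mul_mxdiag_mxblock; apply/eq_mxblock => i j.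
by case: eqVneq => [->|_]; rewrite ?conform_mx_id ?mulmx0.
Qed.

(** A block diagonal matrix only sees the diagonal blocks of what it is traced
    against. *)
Lemma tr_adj_mxdiag p (p_ : 'I_p -> nat) (M : 'M[C]_(\sum_i p_ i))
    (A : forall i, 'M[C]_(p_ i)) :
  \sum_i \tr ((submxblock M i i) ^t* *m A i) = \tr (M ^t* *m \mxdiag_i A i).
Proof.
rewrite -[in RHS](submxblockK (M ^t*)) mul_mxblock_mxdiag mxtrace_mxblock.
by apply: eq_bigr => i _; congr (\tr (_ *m _)); apply/matrixP=> j k; rewrite !mxE.
Qed.

Lemma submxcol_mxdiag_mul p (p_ : 'I_p -> nat) m (A : forall i, 'M[C]_(p_ i))
    (V : 'M[C]_(\sum_i p_ i, m)) k :
  submxcol (\mxdiag_i A i *m V) k = A k *m submxcol V k.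
Proof. by rewrite -{1}(submxcolK V) mul_mxdiag_mxcol mxcolK. Qed.

(** The i-th summand E of C^c (x) E is stable under 1 (x) M, which acts on it
    as M. *)
Lemma rowsub_mult_repr c d m (M : 'M[C]_d) (V : 'M[C]_(c * d, m)) (i : 'I_c) :
  rowsub (fun s => mxtens_index (i, s)) (((1%:M : 'M_c) *t M) *m V) =
  M *m rowsub (fun s => mxtens_index (i, s)) V.
Proof.
apply/matrixP => s t; rewrite !mxE sum_mxtens.
rewrite (bigD1 i) //= [X in _ + X]big1 => [|j j_i].
  by rewrite addr0; apply: eq_bigr => r _; rewrite tensmxE !mxE eqxx mul1r.
by apply: big1 => r _; rewrite tensmxE mxE eq_sym (negPf j_i) !mul0r.
Qed.

End TensorAlgebra.

(** * Actions of elements of C[G x G] and their naturality *)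

Section Quantizers.

Variables (C : numClosedFieldType) (gT : finGroupType).
Local Notation gmod := (mx_representation C [set: gT]).
Implicit Types (n m : nat).

Section Naturality.

Variable q : {ffun gT * gT -> C}.
Local Notation T := (quantizer_action q).

Lemma action_natural n n' m m' (X : gmod n) (X' : gmod n') (Y : gmod m)
    (Y' : gmod m') (f : 'M[C]_(n', n)) (h : 'M[C]_(m', m)) :
  intertwines X X' f -> intertwines Y Y' h ->
  (f *t h) *m T X Y = T X' Y' *m (f *t h).
Proof.
move=> fP hP; rewrite mulmx_sumr mulmx_suml; apply: eq_bigr => g _.
rewrite mulmx_sumr mulmx_suml; apply: eq_bigr => k _.
by rewrite -scalemxAl -scalemxAr !tensmx_mul fP hP.
Qed.

Lemma intertwines1 n (X : gmod n) : intertwines X X 1%:M.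
Proof. by move=> g; rewrite mul1mx mulmx1. Qed.

Lemma intertwinesM n m p (X : gmod n) (Y : gmod m) (Z : gmod p) f h :
  intertwines Y Z f -> intertwines X Y h -> intertwines X Z (f *m h).
Proof. by move=> fP hP g; rewrite -mulmxA hP !mulmxA fP. Qed.

Lemma intertwines_tens n n' m m' (X : gmod n) (X' : gmod n') (Y : gmod m)
    (Y' : gmod m') (f : 'M[C]_(n', n)) (h : 'M[C]_(m', m)) :
  intertwines X X' f -> intertwines Y Y' h ->
  intertwines (tens_repr X Y) (tens_repr X' Y') (f *t h).
Proof. by move=> fP hP g; rewrite /= !tensmx_mul fP hP. Qed.

Definition coherence_lhs n m p (X : gmod n) (Y : gmod m) (Z : gmod p) :=
  castmx (mulnA n m p, mulnA n m p)
    (T X (tens_repr Y Z) *m ((1%:M : 'M[C]_n) *t T Y Z)).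

Definition coherence_rhs n m p (X : gmod n) (Y : gmod m) (Z : gmod p) :=
  T (tens_repr X Y) Z *m (T X Y *t (1%:M : 'M[C]_p)).

Section Triple.

Variables (n n' m m' p p' : nat) (X : gmod n) (X' : gmod n') (Y : gmod m).
Variables (Y' : gmod m') (Z : gmod p) (Z' : gmod p').
Variables (f : 'M[C]_(n', n)) (h : 'M[C]_(m', m)) (k : 'M[C]_(p', p)).
Hypotheses (fP : intertwines X X' f) (hP : intertwines Y Y' h).
Hypothesis kP : intertwines Z Z' k.

Lemma coherence_lhs_natural :
  (f *t h *t k) *m coherence_lhs X Y Z = coherence_lhs X' Y' Z' *m (f *t h *t k).
Proof.
rewrite -tensmxA /coherence_lhs -!castmxM mulmxA; congr castmx.
rewrite (action_natural fP (intertwines_tens hP kP)) -!mulmxA; congr (_ *m _).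
by rewrite !tensmx_mul (action_natural hP kP) mulmx1 mul1mx.
Qed.

Lemma coherence_rhs_natural :
  (f *t h *t k) *m coherence_rhs X Y Z = coherence_rhs X' Y' Z' *m (f *t h *t k).
Proof.
rewrite /coherence_rhs mulmxA (action_natural (intertwines_tens fP hP) kP) -!mulmxA.
by congr (_ *m _); rewrite !tensmx_mul (action_natural fP hP) mulmx1 mul1mx.
Qed.

End Triple.

(** By naturality along f (x) h, which is onto; the lemma serves to pass between
    E_0 and the trivial module. *)
Lemma action_unit_iso n n' m m' (X : gmod n) (X' : gmod n') (Y : gmod m)
    (Y' : gmod m') (f : 'M[C]_(n', n)) (f' : 'M[C]_(n, n'))
    (h : 'M[C]_(m', m)) (h' : 'M[C]_(m, m')) :
  intertwines X X' f -> intertwines Y Y' h -> f *m f' = 1%:M ->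
  h *m h' = 1%:M -> T X Y = 1%:M -> T X' Y' = 1%:M.
Proof.
move=> fP hP ff' hh' T1.
have ffhh : (f *t h) *m (f' *t h') = 1%:M by rewrite tensmx_mul ff' hh' tensmx11.
by rewrite -[LHS]mulmx1 -ffhh mulmxA -(action_natural fP hP) T1 mulmx1.
Qed.

End Naturality.

(** * Reduction to irreducible modules *)

Section Reducibility.

Variable D : irr_reps C gT.
Local Notation E a := (irr_mx a).
Local Notation irr := ('I_(nirr D)).

Lemma card_group_neq0 : #|[set: gT]|%:R != 0 :> C.
Proof. by rewrite Num.Theory.pnatr_eq0 -lt0n cardG_gt0. Qed.

Lemma rsim_intertwines n m (X : gmod n) (Y : gmod m) :
  mx_rsim X Y -> exists f, exists h, [/\ intertwines X Y f,
    intertwines Y X h, f *m h = 1%:M & h *m f = 1%:M].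
Proof.
case=> B def_n; case: _ / def_n in Y B *; rewrite row_free_unit => uB homB.
exists (invmx B), B; split=> [g|g||]; rewrite ?mulmxV ?mulVmx ?homB //.
by apply: (canRL (mulmxK uB)); rewrite -mulmxA homB ?inE // mulKmx.
Qed.

(** Complete reducibility, stated as an induction principle so that no indexed
    family of summands is needed: the identity of a module is a sum of
    composites X -> E_a -> X.  Splitting X as U (+) W by Maschke's theorem, each
    of the two projections factors through a module of smaller dimension, to
    which the induction hypothesis applies with the predicate transported along
    the factorization.  The predicate is boolean, which makes the excluded
    middle available for the irreducibility of X. *)
Lemma irr_span n (X : gmod n) (P : pred 'M[C]_n) :
  P 0 -> (forall A B, P A -> P B -> P (A + B)) ->
  (forall (a : irr) s p, intertwines (E a) X s -> intertwines X (E a) p ->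
     P (s *m p)) ->
  P 1%:M.
Proof.
have [k] := ubnP n; elim: k n X P => // k IHk n X P le_nk P0 PD Psp.
have P_sub (U W : 'M_n) : mxmodule X U -> mxmodule X W -> (U :&: W = 0)%MS ->
    (1%:M <= U + W)%MS -> (\rank U < n)%N -> P (proj_mx U W).
  move=> modU modW dxUW UW1 rU.
  have sub_U : (proj_mx U W <= U)%MS by rewrite -[proj_mx _ _]mul1mx proj_mx_sub.
  have hom_f g : X g *m proj_mx U W = proj_mx U W *m X g.
    have /hom_mxP/(_ g (in_setT g)) := submx_trans UW1 (proj_mx_hom dxUW modU modW).
    by rewrite !mul1mx.
  (* U is a space of row vectors while modules act on columns, so its basis
     matrix is a morphism X -> U, and the coordinates of the projector onto U
     along W form a morphism U -> X. *)
  have sP : intertwines (submod_repr modU) X (in_submod U (proj_mx U W)).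
    move=> g; rewrite -in_submodJ // -hom_f in_submodE -mulmxA.
    by rewrite -in_submodE.
  have pP : intertwines X (submod_repr modU) (val_submod (1%:M : 'M_(\rank U))).
    by move=> g; rewrite -val_submodJ ?inE // mul1mx val_submodE.
  have -> : proj_mx U W = in_submod U (proj_mx U W) *m 1%:M *m val_submod 1%:M.
    by rewrite mulmx1 -val_submodE in_submodK.
  apply: (IHk _ (submod_repr modU)
    (fun A => P (in_submod U (proj_mx U W) *m A *m val_submod 1%:M))) => //.
  - exact: leq_trans rU _.
  - by rewrite mulmx0 mul0mx.
  - by move=> A B PA PB; rewrite mulmxDr mulmxDl PD.
  move=> a s p hs hp.
  rewrite (_ : _ *m _ *m _ = (in_submod U (proj_mx U W) *m s) *m
    (p *m val_submod 1%:M)); last by rewrite !mulmxA.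
  by apply: Psp; [apply: intertwinesM sP hs | apply: intertwinesM hp pP].
have [n0 | n_gt0] := posnP n.
  rewrite (_ : 1%:M = 0) //; apply/matrixP => -[i lt_in]; exfalso.
  by rewrite n0 in lt_in.
apply: (@classic_EM (mxnonsimple X 1%:M) (P 1%:M)) => -[[U /and4P[modU _ nzU]]|irrX].
  rewrite mxrank1 => rU.
  have [|W modW UW1 /mxdirect_addsP dxUW] :=
    mx_Maschke_pchar X _ modU (submx1 U).
    by have := card_group_neq0; rewrite -pcharf'_nat.
  have rW : (\rank W < n)%N.
    have := mxrank_disjoint_sum dxUW; rewrite UW1 mxrank1 => rUW.
    rewrite [X in (_ < X)%N]rUW -[X in (X < _)%N]add0n ltn_add2r.
    by rewrite lt0n mxrank_eq0.
  have UW : (1%:M <= U + W)%MS by rewrite UW1.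
  have WU : (1%:M <= W + U)%MS by rewrite addsmxC.
  rewrite -(add_proj_mx dxUW UW) !mul1mx.
  by apply: PD; apply: P_sub => //; rewrite capmxC.
have [|a /rsim_intertwines[f [h [fP hP _ hf]]]] := irr_mx_complete D (X := X).
  by apply/mxsimpleP; split; rewrite ?mxmodule1 // -mxrank_eq0 mxrank1 -lt0n.
by rewrite -hf; apply: Psp hP fP.
Qed.

(** When L and R are values of natural families at X, they can be moved across
    F s in the hypothesis, which becomes an equation at E_a.  A general F allows
    one tensor factor to be treated at a time. *)
Lemma eq_on_irr n (X : gmod n) m m' (F : 'M[C]_n -> 'M[C]_(m, m'))
    k (L R : 'M[C]_(k, m)) :
  {morph F : A B / A + B} ->
  (forall (a : irr) s p, intertwines (E a) X s -> intertwines X (E a) p ->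
     L *m F (s *m p) = R *m F (s *m p)) ->
  L *m F 1%:M = R *m F 1%:M.
Proof.
move=> FD LR; apply/eqP.
apply: (irr_span (P := fun A => L *m F A == R *m F A)) => [|A B|a s p hs hp].
- have /eqP := FD 0 0; rewrite addr0 -subr_eq0 opprD addNKr oppr_eq0 => /eqP ->.
  by rewrite !mulmx0.
- by move=> /eqP LA /eqP LB; rewrite FD !mulmxDr LA LB.
by apply/eqP/(LR a).
Qed.

(** * Schur orthogonality and Fourier inversion *)

Lemma irr_dim_gt0 (a : irr) : (0 < irr_dim a)%N.
Proof. by have /mx_irrP[] := irr_mx_irr a. Qed.

(** The kernel and the image of f are submodules, so that a nonzero f is
    bijective. *)
Lemma schur_neq (a b : irr) f : intertwines (E a) (E b) f -> a != b -> f = 0.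
Proof.
move=> fP; apply: contraNeq => nzf; apply/eqP.
have /mx_irrP[_ irrA] := irr_mx_irr a; have /mx_irrP[_ irrB] := irr_mx_irr b.
have free_f : row_free f.
  rewrite -kermx_eq0; apply: contraTT isT => nz_ker.
  have full: row_full (kermx f).
    apply: irrB nz_ker; apply/mxmoduleP => g _; apply/sub_kermxP.
    by rewrite -mulmxA -fP mulmxA mulmx_ker mul0mx.
  move/negP: nzf; case; move: full; rewrite -sub1mx => /sub_kermxP.
  by rewrite mul1mx => ->.
have full_f : row_full f.
  rewrite /row_full -(genmxE f); apply: irrA.
    apply/mxmoduleP => g _; rewrite (eqmxMr _ (genmxE f)) genmxE fP.
    exact: submxMl.
  by rewrite -mxrank_eq0 genmxE mxrank_eq0.
apply/esym/(@irr_mx_inj _ _ D); exists f => //.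
by rewrite -(eqP free_f) (eqP full_f).
Qed.

(** f - l is not injective when l is an eigenvalue of f. *)
Lemma schur_scalar (a : irr) f :
  intertwines (E a) (E a) f -> is_scalar_mx f.
Proof.
move=> fP; have [l /eigenvalueP[v vf nzv]] := eigenvalue_closed f (irr_dim_gt0 a).
apply/is_scalar_mxP; exists l; apply/eqP; rewrite -subr_eq0.
apply: contraNT nzv => nz_fl; have := mx_Schur (irr_mx_irr a) _ nz_fl.
have cent : centgmx (E a) (f - l%:M).
  by apply/centgmxP=> g _; rewrite mulmxBl mulmxBr fP scalar_mxC.
move=> /(_ cent) u_fl; rewrite -(mulmxK u_fl v) mulmxBr vf mul_mx_scalar.
by rewrite subrr mul0mx.
Qed.

Lemma irr_mx_adj (a : irr) g : (E a g) ^t* = E a g^-1%g.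
Proof. by rewrite repr_mxV ?inE // invmx_unitary // irr_mx_unitary. Qed.

Lemma intertwines_average (a b : irr) (M : 'M[C]_(irr_dim b, irr_dim a)) :
  intertwines (E a) (E b) (\sum_g E b g *m M *m (E a g) ^t*).
Proof.
move=> h; rewrite mulmx_suml mulmx_sumr (reindex_inj (mulgI h)) /=.
apply: eq_bigr => g _; rewrite !irr_mx_adj invMg !repr_mxM ?inE //.
by rewrite -!mulmxA -repr_mxM ?inE // mulVg repr_mx1 mulmx1.
Qed.

(** Averaging the elementary matrix of index (j, v) produces the sums of
    products of matrix coefficients, to which Schur's lemma thereby applies. *)
Lemma average_entry (a b : irr) u v i j :
  (\sum_g E b g *m delta_mx j v *m (E a g) ^t*) i u =
  \sum_g (E a g u v)^* * E b g i j.
Proof.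
rewrite summxE; apply: eq_bigr => g _.
rewrite mxE (bigD1 v) //= big1 => [|w w_v]; last first.
  rewrite mxE big1 ?mul0r // => z _; rewrite !mxE.
  by rewrite (negPf w_v) andbF mulr0.
rewrite addr0 !mxE (bigD1 j) //= big1 => [|z z_j]; last first.
  by rewrite !mxE (negPf z_j) mulr0.
by rewrite !mxE !eqxx mulr1 addr0 mulrC.
Qed.

Lemma orthogonality_neq (a b : irr) u v i j : a != b ->
  \sum_g (E a g u v)^* * E b g i j = 0.
Proof.
move=> ab; rewrite -average_entry.
by rewrite (schur_neq (intertwines_average (delta_mx j v)) ab) mxE.
Qed.

(** The average is a scalar matrix, and its trace determines the scalar. *)
Lemma orthogonality (a : irr) u v i j :
  (irr_dim a)%:R / #|[set: gT]|%:R * \sum_g (E a g u v)^* * E a g i j =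
  (u == i)%:R * (v == j)%:R.
Proof.
rewrite -average_entry.
have /is_scalar_mxP[l Dl] := schur_scalar (intertwines_average (delta_mx j v)).
have : (irr_dim a)%:R * l = #|[set: gT]|%:R * (v == j)%:R.
  have := congr1 mxtrace Dl; rewrite mxtrace_scalar mulr_natl => <-.
  rewrite linear_sum /= (eq_bigr (fun=> (v == j)%:R)) => [|g _].
    by rewrite sumr_const cardsT mulr_natl.
  rewrite mxtrace_mulC mulmxA irr_mx_adj -repr_mxM ?inE // mulVg repr_mx1.
  rewrite mul1mx /mxtrace (bigD1 j) //= big1 => [|k k_j].
    by rewrite !mxE eqxx addr0 eq_sym.
  by rewrite !mxE (negPf k_j).
move=> dl; rewrite Dl mxE -[l *+ _]mulr_natr (eq_sym i) mulrA (mulrAC _ _ l) dl.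
by rewrite [_ * _ / _]mulrAC mulfV ?card_group_neq0 // mul1r mulrC.
Qed.

(** The inverse Fourier transform on G x G of a family of operators on the
    irreducible modules E_a (x) E_b. *)
Definition fourier_coef (A : forall a b : irr, 'M[C]_(irr_dim a * irr_dim b)) :
    {ffun gT * gT -> C} :=
  [ffun gh => (#|[set: gT]|%:R ^+ 2)^-1 *
    \sum_a \sum_b (irr_dim a * irr_dim b)%:R *
      \tr ((E a gh.1 *t E b gh.2) ^t* *m A a b)].

(** Expanding the trace writes every entry of the left-hand side as a sum of the
    entries of A against products of two normalized sums of coefficients, one
    for each factor G; orthogonality leaves a single term. *)
Lemma fourier_inversion A (a b : irr) :
  quantizer_action (fourier_coef A) (E a) (E b) = A a b.
Proof.
apply/matrixP => r s.
pose w (x y : irr) u v i j := (irr_dim x)%:R / #|[set: gT]|%:R *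
  \sum_g (E x g u v)^* * E y g i j.
pose r' := mxtens_unindex r; pose s' := mxtens_unindex s.
transitivity (\sum_x \sum_y \sum_i \sum_j A x y j i *
    (w x a (mxtens_unindex j).1 (mxtens_unindex i).1 r'.1 s'.1 *
     w y b (mxtens_unindex j).2 (mxtens_unindex i).2 r'.2 s'.2)).
  rewrite /quantizer_action [in LHS]pair_big summxE; under eq_bigr => gh _ do
    rewrite !mxE ffunE mulr_sumr mulr_suml.
  rewrite exchange_big; apply: eq_bigr => x _.
  under eq_bigr => gh _ do rewrite mulr_sumr mulr_suml.
  rewrite exchange_big; apply: eq_bigr => y _.
  under eq_bigr => gh _ do rewrite !mulr_sumr mulr_suml.
  rewrite exchange_big; apply: eq_bigr => i _.
  under eq_bigr => gh _ do rewrite mxE !mulr_sumr mulr_suml.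
  rewrite exchange_big; apply: eq_bigr => j _.
  rewrite [in RHS]/w [in RHS]mulrACA big_distrlr [in RHS]pair_big.
  rewrite !mulr_sumr; apply: eq_bigr => -[g h] _ /=.
  by rewrite !mxE /= natrM rmorphM; field; apply: card_group_neq0.
have w0 x y u v i j : x != y -> w x y u v i j = 0.
  by move=> xy; rewrite /w orthogonality_neq ?mulr0.
rewrite (bigD1 a) //= [X in _ + X]big1 => [|x x_a]; last first.
  apply: big1 => y _; apply: big1 => i _; apply: big1 => j _.
  by rewrite w0 // mul0r mulr0.
rewrite (bigD1 b) //= [X in _ + X + _]big1 => [|y y_b]; last first.
  apply: big1 => i _; apply: big1 => j _.
  by rewrite [w y b _ _ _ _]w0 // !mulr0.
have wE i j : w a a (mxtens_unindex j).1 (mxtens_unindex i).1 r'.1 s'.1 *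
    w b b (mxtens_unindex j).2 (mxtens_unindex i).2 r'.2 s'.2 =
    ((j == r) && (i == s))%:R.
  rewrite /w /r' /s' !orthogonality -!natrM !mulnb andbACA -!xpair_eqE.
  rewrite -!surjective_pairing [in LHS]xpair_eqE [in RHS]xpair_eqE.
  by rewrite !(can_eq (@mxtens_unindexK _ _)).
rewrite (bigD1 s) //= [X in _ + X + _ + _]big1 => [|i i_s]; last first.
  by apply: big1 => j _; rewrite wE (negPf i_s) andbF mulr0.
rewrite (bigD1 r) //= [X in _ + X + _ + _ + _]big1 => [|j j_r]; last first.
  by rewrite wE (negPf j_r) mulr0.
by rewrite wE !eqxx mulr1 !addr0.
Qed.

(** * Extension of identities from irreducible modules to all modules *)

Section Extension.

Variable q : {ffun gT * gT -> C}.
Local Notation T := (quantizer_action q).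

Lemma coherent_ext :
  (forall a b c : irr,
    coherence_lhs q (E a) (E b) (E c) = coherence_rhs q (E a) (E b) (E c)) ->
  forall n m k (X : gmod n) (Y : gmod m) (Z : gmod k),
    coherence_lhs q X Y Z = coherence_rhs q X Y Z.
Proof.
move=> coh n m k X Y Z; rewrite -[LHS]mulmx1 -[RHS]mulmx1 -!tensmx11.
apply: (eq_on_irr (X := X) (F := fun A => A *t 1%:M *t 1%:M)) => [A B|a s p sP pP].
  by rewrite !tensmxDl.
apply: (eq_on_irr (X := Y) (F := fun A => s *m p *t A *t 1%:M)) => [A B|b t u tP uP].
  by rewrite tensmxDr tensmxDl.
apply: (eq_on_irr (X := Z) (F := fun A => s *m p *t (t *m u) *t A)) =>
    [A B|c v w vP wP]; first by rewrite tensmxDr.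
rewrite -!tensmx_mul !mulmxA -(coherence_lhs_natural q sP tP vP) coh.
by rewrite -(coherence_rhs_natural q sP tP vP).
Qed.

Lemma action_intertwines_ext :
  (forall a b : irr, intertwines (tens_repr (E a) (E b))
     (tens_repr (E a) (E b)) (T (E a) (E b))) ->
  forall n m (X : gmod n) (Y : gmod m),
    intertwines (tens_repr X Y) (tens_repr X Y) (T X Y).
Proof.
move=> morphE n m X Y g; rewrite -[LHS]mulmx1 -[RHS]mulmx1 -!tensmx11.
apply: (eq_on_irr (X := X) (F := fun A => A *t 1%:M)) => [A B|a s p sP pP].
  by rewrite !tensmxDl.
apply: (eq_on_irr (X := Y) (F := fun A => s *m p *t A)) => [A B|b t u tP uP].
  by rewrite tensmxDr.
have stP := intertwines_tens sP tP.
rewrite -!tensmx_mul !mulmxA; congr (_ *m _).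
rewrite -!mulmxA -(stP g) -(action_natural q sP tP) !mulmxA.
by rewrite -(action_natural q sP tP) -(stP g) -!mulmxA morphE.
Qed.

Lemma action_unitr_ext m (Y : gmod m) :
  (forall a : irr, T (E a) Y = 1%:M) -> forall n (X : gmod n), T X Y = 1%:M.
Proof.
move=> unitE n X; rewrite -[LHS]mulmx1 -[RHS]mulmx1 -!tensmx11.
apply: (eq_on_irr (X := X) (F := fun A => A *t 1%:M)) => [A B|a s p sP pP].
  by rewrite !tensmxDl.
have sp1 : s *m p *t 1%:M = (s *t (1%:M : 'M_m)) *m (p *t 1%:M).
  by rewrite tensmx_mul mulmx1.
rewrite sp1 !mulmxA -(action_natural q sP (intertwines1 Y)) unitE.
by rewrite tensmx11 mulmx1 mul1mx.
Qed.

Lemma action_unitl_ext n (X : gmod n) :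
  (forall a : irr, T X (E a) = 1%:M) -> forall m (Y : gmod m), T X Y = 1%:M.
Proof.
move=> unitE m Y; rewrite -[LHS]mulmx1 -[RHS]mulmx1 -!tensmx11.
apply: (eq_on_irr (X := Y) (F := fun A => 1%:M *t A)) => [A B|a s p sP pP].
  by rewrite !tensmxDr.
have sp1 : 1%:M *t (s *m p) = ((1%:M : 'M_n) *t s) *m (1%:M *t p).
  by rewrite tensmx_mul mulmx1.
rewrite sp1 !mulmxA -(action_natural q (intertwines1 X) sP) unitE.
by rewrite tensmx11 mulmx1 mul1mx.
Qed.

End Extension.

(** * The Clebsch-Gordan decomposition *)

Section Multiplicities.

Variable N : clebsch_gordan D.

Lemma cg_proj_morph a b k (i : 'I_(cg_mult N a b k)) :
  intertwines (tens_repr (E a) (E b)) (E k) (cg_proj i).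
Proof.
move=> g; rewrite /cg_proj mul_rowsub_mx submxcol_mul cg_iso_morph.
by rewrite submxcol_mxdiag_mul rowsub_mult_repr.
Qed.

(** The adjoint of a morphism of unitary representations is a morphism. *)
Lemma cg_incl_morph a b k (i : 'I_(cg_mult N a b k)) :
  intertwines (E k) (tens_repr (E a) (E b)) ((cg_proj i) ^t*).
Proof.
move=> g; have := congr1 (fun A => A ^t*) (cg_proj_morph i g^-1%g).
rewrite !adj_mul /= adj_tens !irr_mx_adj !invgK => <-; exact: erefl.
Qed.

(** This is nu^* nu = 1 for nu = cg_iso N a b, grouped by rows of nu: the rows of
    cg_proj i are those of nu that belong to the i-th copy of E_k. *)
Lemma cg_complete a b :
  \sum_k \sum_(i < cg_mult N a b k) (cg_proj i) ^t* *m cg_proj i = 1%:M.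
Proof.
have [_ <-] := cg_iso_unitary N a b; set V := cg_iso N a b.
have -> : V ^t* = \mxrow_k (submxcol V k) ^t*.
  by rewrite -{1}(submxcolK V); apply/matrixP => i j; rewrite !mxE.
rewrite -[X in _ *m X](submxcolK V) mul_mxrow_mxcol.
apply: eq_bigr => k _; apply/matrixP => r s.
rewrite summxE !mxE sum_mxtens; apply: eq_bigr => i _.
by rewrite !mxE; apply: eq_bigr => t _; rewrite !mxE.
Qed.

(** The rows of cg_proj i are rows of the unitary cg_iso N a b, of norm 1. *)
Lemma cg_proj_neq0 a b k (i : 'I_(cg_mult N a b k)) : cg_proj i != 0.
Proof.
apply/eqP => proj0.
pose r : 'I_(\sum_k cg_mult N a b k * irr_dim k) :=
  tagnat.Rank k (mxtens_index (i, Ordinal (irr_dim_gt0 k))).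
have [/matrixP/(_ r r)] := cg_iso_unitary N a b.
rewrite !mxE eqxx big1 => [/esym/eqP|j _]; first by rewrite oner_eq0.
have /matrixP/(_ (Ordinal (irr_dim_gt0 k)) j) := proj0.
by rewrite !mxE => ->; rewrite mul0r.
Qed.

Section Action.

Variable q : {ffun gT * gT -> C}.
Local Notation T := (quantizer_action q).

(** Naturality along the projections and inclusions of the decomposition moves
    the action on a reducible factor to its irreducible summands. *)
Lemma action_decompr (a b c : irr) :
  T (E a) (tens_repr (E b) (E c)) =
  \sum_e \sum_(i < cg_mult N b c e)
    (1%:M *t cg_proj i) ^t* *m T (E a) (E e) *m (1%:M *t cg_proj i).
Proof.
rewrite -[LHS]mulmx1 -tensmx11 -(cg_complete b c) tensmx_sumr mulmx_sumr.
apply: eq_bigr => e _; rewrite tensmx_sumr mulmx_sumr; apply: eq_bigr => i _.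
rewrite adj_tens adj1 (action_natural q (intertwines1 (E a)) (cg_incl_morph i)).
by rewrite -mulmxA tensmx_mul mulmx1.
Qed.

Lemma action_decompl (a b c : irr) :
  T (tens_repr (E a) (E b)) (E c) =
  \sum_x \sum_(i < cg_mult N a b x)
    (cg_proj i *t 1%:M) ^t* *m T (E x) (E c) *m (cg_proj i *t 1%:M).
Proof.
rewrite -[LHS]mulmx1 -tensmx11 -(cg_complete a b) tensmx_suml mulmx_sumr.
apply: eq_bigr => x _; rewrite tensmx_suml mulmx_sumr; apply: eq_bigr => i _.
rewrite adj_tens adj1 (action_natural q (cg_incl_morph i) (intertwines1 (E c))).
by rewrite -mulmxA tensmx_mul mulmx1.
Qed.

End Action.

Variable qh : forall a b k, 'M[C]_(cg_mult N a b k * irr_dim k).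

(** * The quantizer attached to a family of operators *)

Lemma quantizer_ofE : quantizer_of qh = fourier_coef (qh_op qh).
Proof.
apply/ffunP => -[g h]; rewrite !ffunE; congr (_ * _).
apply: eq_bigr => a _; apply: eq_bigr => b _; congr (_ * _).
rewrite /cg_block tr_adj_mxdiag /qh_op !adj_mul trmxCK /=.
by rewrite -!mulmxA mxtrace_mulC -!mulmxA.
Qed.

Lemma action_quantizer_of (a b : irr) :
  quantizer_action (quantizer_of qh) (E a) (E b) = qh_op qh a b.
Proof. by rewrite quantizer_ofE fourier_inversion. Qed.

Lemma qh_op_morph (a b : irr) :
  (forall k, intertwines (@mult_repr _ _ D (cg_mult N a b k) k)
     (@mult_repr _ _ D (cg_mult N a b k) k) (qh a b k)) ->
  intertwines (tens_repr (E a) (E b)) (tens_repr (E a) (E b)) (qh_op qh a b).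
Proof.
move=> qhP g; have [VV' V'V] := cg_iso_unitary N a b.
have VP := cg_iso_morph N a b g; rewrite /qh_op; set V := cg_iso N a b in VV' V'V VP *.
have V'P : tens_repr (E a) (E b) g *m V ^t* =
    V ^t* *m \mxdiag_k mult_repr (cg_mult N a b k) k g.
  by rewrite -[RHS]mulmx1 -VV' !mulmxA -(mulmxA (V ^t*)) -VP mulmxA V'V mul1mx.
rewrite -!mulmxA VP !mulmxA V'P -!mulmxA; congr (_ *m _); rewrite !mulmxA.
congr (_ *m _); rewrite !mul_mxdiag.
by apply: eq_mxdiag => k; apply: qhP.
Qed.

(** Conjugation by the unitary cg_iso N a b carries the block diagonal matrix to
    the operator. *)
Lemma qh_op1 (a b : irr) : qh_op qh a b = 1%:M <-> forall k, qh a b k = 1%:M.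
Proof.
rewrite /qh_op; have [VV' V'V] := cg_iso_unitary N a b.
set V := cg_iso N a b in VV' V'V *; split=> [op1 k | qh1].
  have qh1 : \mxdiag_k qh a b k = 1%:M.
    transitivity (V *m (V ^t* *m \mxdiag_k qh a b k *m V) *m V ^t*).
      by rewrite !mulmxA VV' mul1mx -mulmxA VV' mulmx1.
    by rewrite op1 mulmx1 VV'.
  by rewrite -(submxblock_diag (qh a b) k) qh1 -mxdiagZ submxblock_diag.
by rewrite (eq_mxdiag (B'_ := fun k => 1%:M)) // mxdiagZ mulmx1.
Qed.

(** E_a (x) triv_repr is E_a up to a cast of dimensions, so Schur's lemma applies. *)
Lemma schur_tens_trivr (a k : irr) f :
  intertwines (tens_repr (E a) (triv_repr C gT)) (E k) f -> a != k -> f = 0.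
Proof.
move=> fP ak; apply: (can_inj (castmxK (erefl _) (muln1 _))).
rewrite (castmx_const (_, _)); apply: schur_neq ak => g.
have -> : E a g = castmx (muln1 _, muln1 _) (E a g *t (1%:M : 'M_1)).
  by rewrite tens_mx_scalar scale1r castmx_comp castmx_id.
by rewrite -castmxM fP (castmxM _ (erefl _)) castmx_id.
Qed.

Lemma schur_tens_trivl (a k : irr) f :
  intertwines (tens_repr (triv_repr C gT) (E a)) (E k) f -> a != k -> f = 0.
Proof.
move=> fP ak; apply: (can_inj (castmxK (erefl _) (mul1n _))).
rewrite (castmx_const (_, _)); apply: schur_neq ak => g.
have -> : E a g = castmx (mul1n _, mul1n _) ((1%:M : 'M_1) *t E a g).
  by rewrite tens_scalar_mx scale1r castmx_comp castmx_id.
by rewrite -castmxM fP (castmxM _ (erefl _)) castmx_id.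
Qed.

(** A copy of E_k in E_a (x) E_0, which is isomorphic to E_a, would give a
    nonzero morphism E_a -> E_k. *)
Lemma cg_mult_0r (a k : irr) : a != k -> 'I_(cg_mult N a (irr0 D) k) -> False.
Proof.
move=> ak i; have [f [h [_ hP _ hf]]] := rsim_intertwines (irr0_triv D).
have /(_ ak) := schur_tens_trivr (intertwinesM (cg_proj_morph i)
  (intertwines_tens (intertwines1 (E a)) hP)).
move=> /(congr1 (fun A => A *m (1%:M *t f))).
rewrite -mulmxA tensmx_mul mul1mx hf tensmx11 mulmx1 mul0mx => /eqP.
exact/negP/cg_proj_neq0.
Qed.

Lemma cg_mult_0l (a k : irr) : a != k -> 'I_(cg_mult N (irr0 D) a k) -> False.
Proof.
move=> ak i; have [f [h [_ hP _ hf]]] := rsim_intertwines (irr0_triv D).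
have /(_ ak) := schur_tens_trivl (intertwinesM (cg_proj_morph i)
  (intertwines_tens hP (intertwines1 (E a)))).
move=> /(congr1 (fun A => A *m (f *t 1%:M))).
rewrite -mulmxA tensmx_mul mul1mx hf tensmx11 mulmx1 mul0mx => /eqP.
exact/negP/cg_proj_neq0.
Qed.

(** The blocks of index k <> a are empty matrices, hence equal to 1. *)
Lemma qh_op_unitr (a : irr) :
  qh_op qh a (irr0 D) = 1%:M <-> qh a (irr0 D) a = 1%:M.
Proof.
rewrite qh_op1; split=> [-> // | qh1 k].
have [<- // | ak] := eqVneq a k.
apply/matrixP => i; case: (mxtens_indexP i) => j ?; have [] := cg_mult_0r ak j.
Qed.

Lemma qh_op_unitl (a : irr) :
  qh_op qh (irr0 D) a = 1%:M <-> qh (irr0 D) a a = 1%:M.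
Proof.
rewrite qh_op1; split=> [-> // | qh1 k].
have [<- // | ak] := eqVneq a k.
apply/matrixP => i; case: (mxtens_indexP i) => j ?; have [] := cg_mult_0l ak j.
Qed.

Local Notation T := (quantizer_action (quantizer_of qh)).

Lemma action_unitr :
  (forall n (X : gmod n), T X (triv_repr C gT) = 1%:M) <->
  (forall a, qh a (irr0 D) a = 1%:M).
Proof.
have [f [h [fP hP fh hf]]] := rsim_intertwines (irr0_triv D).
split=> [T1 a | qh1 n X].
  apply/qh_op_unitr; rewrite -action_quantizer_of.
  exact: (action_unit_iso (intertwines1 _) hP (mul1mx _) hf).
apply: action_unitr_ext => a.
apply: (action_unit_iso (intertwines1 _) fP (mul1mx _) fh).
by rewrite action_quantizer_of; apply/qh_op_unitr.
Qed.

Lemma action_unitl :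
  (forall n (X : gmod n), T (triv_repr C gT) X = 1%:M) <->
  (forall a, qh (irr0 D) a a = 1%:M).
Proof.
have [f [h [fP hP fh hf]]] := rsim_intertwines (irr0_triv D).
split=> [T1 a | qh1 n X].
  apply/qh_op_unitl; rewrite -action_quantizer_of.
  exact: (action_unit_iso hP (intertwines1 _) hf (mul1mx _)).
apply: action_unitl_ext => a.
apply: (action_unit_iso fP (intertwines1 _) fh (mul1mx _)).
by rewrite action_quantizer_of; apply/qh_op_unitl.
Qed.

Lemma coherence_lhs_irr (a b c : irr) :
  coherence_lhs (quantizer_of qh) (E a) (E b) (E c) =
  castmx (mulnA _ _ _, mulnA _ _ _)
    (qh_op_tensr qh a b c *m (1%:M *t qh_op qh b c)).
Proof.
rewrite /coherence_lhs action_decompr action_quantizer_of.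
congr (castmx _ (_ *m _)); apply: eq_bigr => e _; apply: eq_bigr => i _.
by rewrite action_quantizer_of.
Qed.

Lemma coherence_rhs_irr (a b c : irr) :
  coherence_rhs (quantizer_of qh) (E a) (E b) (E c) =
  qh_op_tensl qh a b c *m (qh_op qh a b *t 1%:M).
Proof.
rewrite /coherence_rhs action_decompl action_quantizer_of.
congr (_ *m _); apply: eq_bigr => x _; apply: eq_bigr => i _.
by rewrite action_quantizer_of.
Qed.

Lemma quantizer_iff_quadratic :
  (forall a b k, intertwines (@mult_repr _ _ D (cg_mult N a b k) k)
     (@mult_repr _ _ D (cg_mult N a b k) k) (qh a b k)) ->
  is_quantizer (quantizer_of qh) <-> quadratic_system qh.
Proof.
move=> qhP; split=> [[_ _ coh unitr unitl] | [quad unit]].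
  split=> [a b c | a]; first by rewrite -coherence_lhs_irr -coherence_rhs_irr; apply: coh.
  by split; [apply action_unitr | apply action_unitl].
split=> [n m X Y|n n' m m' X X' Y Y' f h|n m p X Y Z||].
- apply: action_intertwines_ext => a b.
  by rewrite action_quantizer_of; apply: qh_op_morph.
- exact: action_natural.
- apply: coherent_ext => a b c.
  by rewrite coherence_lhs_irr coherence_rhs_irr.
- by apply/action_unitr => a; case: (unit a).
by apply/action_unitl => a; case: (unit a).
Qed.

End Multiplicities.

End Reducibility.

End Quantizers.

Theorem theorem5 (R : realType) (gT : finGroupType)
    (D : irr_reps R[i] gT) (N : clebsch_gordan D)
    (qh : forall a b k : 'I_(nirr D), 'M[R[i]]_(cg_mult N a b k * irr_dim k))
    (qh_morph : forall a b k : 'I_(nirr D),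
       intertwines (mult_repr (cg_mult N a b k) k)
         (mult_repr (cg_mult N a b k) k) (qh a b k)) :
  is_quantizer (quantizer_of qh) <-> quadratic_system qh.
Proof. exact: quantizer_iff_quadratic. Qed.
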